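(* For every path-connected topological space $X$ and every integer $n\ge 2$, $$\operatorname{cat}(X^{n-1})\le \operatorname{TC}_n(X)\le \operatorname{cat}(X^n).$$
   Context: All numerical invariants are normalized and may take the value $\infty$ (when no finite number as required exists). For a space $Z$, $\operatorname{cat}(Z)$ is the (normalized) Lusternik-Schnirelmann category: the least $k$ such that $Z$ has an open cover $A_0,\ldots,A_k$ with each inclusion $A_i\hookrightarrow Z$ null-homotopic. $X^m$ is the $m$-fold cartesian power. The Schwarz genus of a map $p:E\to B$ is the least $k$ such that there is an open cover $U_0,\ldots,U_k$ of $B$ and, for each $i$, a continuous map $s_i:U_i\to E$ with $p s_i$ homotopic to the inclusion $U_i\hookrightarrow B$. For a fibration this is equivalent to requiring honest local sections $ps_i=$ inclusion. Let $J_n$ be the wedge of $n$ copies of $[0,1]$, each with base point $0$, and let $1_i$ denote the point $1$ in the $i$-th copy. $\operatorname{TC}_n(X)$, the $n$-th topological complexity of a path-connected space $X$, is the Schwarz genus of the fibration $e_n:X^{J_n}\to X^n$, $e_n(\gamma)=(\gamma(1_1),\ldots,\gamma(1_n))$, where $X^{J_n}$ is the space of continuous maps $J_n\to X$ with the compact-open topology. *)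

(* Defs.v *)
From HB Require Import structures.
From mathcomp Require Import all_boot all_order all_algebra.
From mathcomp Require Import all_classical all_reals all_analysis homotopy.

Set Implicit Arguments.
Unset Strict Implicit.
Unset Printing Implicit Defensive.

Import Order.TTheory GRing.Theory Num.Theory.
Import numFieldNormedType.Exports.

Local Open Scope classical_set_scope.
Local Open Scope ring_scope.

(* The least natural number satisfying P, or +oo if there is none. *)
Definition least_nat (R : realType) (P : set nat) : \bar R :=
  if pselect (exists k, `[< P k >]) is left ex
  then ((ex_minn ex)%:R)%:E else +oo%E.

Definition unit_interval (R : realType) : Type :=
  set_type (`[0, 1]%classic : set R).

Section unit_interval.
Context (R : realType).

Fact unit_interval_has0 : (0 : R) \in (`[0, 1]%classic : set R).
Proof. by rewrite inE /= in_itv /= lexx ler01. Qed.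

Fact unit_interval_has1 : (1 : R) \in (`[0, 1]%classic : set R).
Proof. by rewrite inE /= in_itv /= lexx ler01. Qed.

HB.instance Definition _ := Topological.copy (unit_interval R)
  (set_type (`[0, 1]%classic : set R)).

Fact unit_interval_neq :
  (exist _ 0 unit_interval_has0 : unit_interval R)
    != exist _ 1 unit_interval_has1.
Proof. by apply/eqP => /(congr1 sval) /= /eqP; rewrite eq_sym oner_eq0. Qed.

HB.instance Definition _ := @isBiPointed.Build (unit_interval R)
  (exist _ 0 unit_interval_has0) (exist _ 1 unit_interval_has1)
  unit_interval_neq.

End unit_interval.

(* The path spaces below are taken from the library: a {path i from x to y}
   is a continuous map i -> X sending zero to x and one to y. *)
Definition path_connected (R : realType) (X : topologicalType) : Prop :=
  forall x y : X, inhabited {path (unit_interval R) from x to y}.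

Definition homotopic (R : realType) (Y Z : topologicalType) (f g : Y -> Z) :
    Prop :=
  exists H : Y * unit_interval R -> Z,
    [/\ continuous H, forall y, H (y, zero) = f y & forall y, H (y, one) = g y].

(* A map is constant when all its values agree. For nonempty Z this is being
   equal to cst z for some z; for empty Z it makes the only map into Z
   null-homotopic, so that the empty space needs no separate convention. *)
Definition null_homotopic (R : realType) (Y Z : topologicalType) (f : Y -> Z) :
    Prop :=
  exists2 c : Y -> Z, (forall y y', c y = c y') & homotopic R f c.

Definition open_cover (Z : topologicalType) (k : nat)
    (A : 'I_k.+1 -> set Z) : Prop :=
  (forall i, open (A i)) /\ \bigcup_i A i = [set: Z].

(* set_type A is A with the subspace topology, and set_val its inclusion. *)
Definition LS_category (R : realType) (Z : topologicalType) : \bar R :=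
  least_nat R [set k | exists A : 'I_k.+1 -> set Z, open_cover A /\
    forall i, null_homotopic R (set_val : set_type (A i) -> Z)].

Definition schwarz_genus (R : realType) (E B : topologicalType) (p : E -> B) :
    \bar R :=
  least_nat R [set k | exists U : 'I_k.+1 -> set B, open_cover U /\
    forall i, exists2 s : set_type (U i) -> E,
      continuous s & homotopic R (p \o s) (set_val : set_type (U i) -> B)].

Definition cart_power (X : topologicalType) (m : nat) : topologicalType :=
  prod_topology (fun _ : 'I_m => X).

Definition mapping_space (J X : topologicalType) : topologicalType :=
  initial_topology
    (fun f : continuousType J X => (f : J -> X) : {compact-open, J -> X}).

Definition star (R : realType) (n : nat) : topologicalType :=
  @wedge 'I_n (fun _ => unit_interval R) (fun _ => zero).

Definition star_end (R : realType) (n : nat) (i : 'I_n) : star R n :=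
  @wedge_lift 'I_n (fun _ => unit_interval R) (fun _ => zero) i one.

Definition star_eval (R : realType) (n : nat) (X : topologicalType)
    (gamma : mapping_space (star R n) X) : cart_power X n :=
  fun i => (gamma : continuousType (star R n) X) (star_end R i).

Definition topological_complexity (R : realType) (n : nat)
    (X : topologicalType) : \bar R :=
  schwarz_genus R (@star_eval R n X).

(* Main.v *)
From HB Require Import structures.
Require Import Defs.
From mathcomp Require Import all_boot all_order all_algebra.
From mathcomp Require Import all_classical all_reals all_analysis homotopy.

Set Implicit Arguments.
Unset Strict Implicit.
Unset Printing Implicit Defensive.

Import Order.TTheory GRing.Theory Num.Theory.
Import numFieldNormedType.Exports.
Local Open Scope classical_set_scope.
Local Open Scope ring_scope.

(* Upper bound: over a set whose inclusion into X^n deforms to a constant z,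
   a constant section at any star whose ends are the coordinates of z works up
   to homotopy; such a star exists by path-connectedness.
   Lower bound: pull a cover of X^n back along y |-> (x0, y). Given a section s
   up to homotopy, each coordinate y_k deforms to the k-th end of s(x0, y),
   slides along that arm to the centre, out along the arm of index 0, and is
   then carried to x0; together these contract the pulled-back set. *)

(** * The unit interval as a retract of the real line *)

Section unit_interval.
Context (R : realType).
Notation I := (unit_interval R).

Lemma clip_subproof (r : R) :
  Num.max 0 (Num.min r 1) \in (`[0, 1]%classic : set R).
Proof.
by rewrite inE /= in_itv /= le_max lexx /= ge_max ler01 ge_min lexx orbT.
Qed.

(** Retraction of the real line onto the interval: time parameters can be computed in [R] and sent
    back without a membership proof each time. *)
Definition clip (r : R) : I := exist _ (Num.max 0 (Num.min r 1)) (clip_subproof r).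

Lemma clip_continuous : continuous clip.
Proof.
apply: continuous_comp_initial => r /=.
apply: (@continuous_max R R (cst 0) (fun r : R => Num.min r 1)).
  exact: cvg_cst.
exact: (@continuous_min R R id (cst 1) r cvg_id (cvg_cst _)).
Qed.

Lemma clip0 : clip 0 = zero.
Proof.
by apply: val_inj => /=; rewrite minEle ler01 maxxx.
Qed.

Lemma clip1 : clip 1 = one.
Proof.
by apply: val_inj => /=; rewrite minxx maxEle ler01.
Qed.

Lemma clip_val (t : I) : clip (val t) = t.
Proof.
case: t => r /[dup] + rI; rewrite inE /= in_itv /= => /andP[r0 r1].
by apply: val_inj => /=; rewrite minEle r1 maxEle r0.
Qed.

(** Compactness comes from the segment in [R], which [clip] maps continuously onto the whole
    type. *)
Lemma unit_interval_compact : compact [set: I].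
Proof.
suff <- : clip @` `[0, 1]%classic = [set: I].
  apply: continuous_compact; last exact: segment_compact.
  apply: continuous_subspaceT; exact: clip_continuous.
apply/seteqP; split=> // t _; exists (val t); last exact: clip_val.
exact/set_mem/valP.
Qed.

Lemma val_continuous : continuous (val : I -> R).
Proof. exact: initial_continuous. Qed.

Lemma unit_interval_regular : regular_space I.
Proof. exact: (@uniform_regular (set_type (`[0, 1]%classic : set R))). Qed.

End unit_interval.

(** Reduces each bound to a construction on covers: one that is good for the larger invariant yields
    one with equally many sets that is good for the smaller. *)
Lemma least_nat_le (R : realType) (P Q : set nat) : Q `<=` P ->
  (least_nat R P <= least_nat R Q)%E.
Proof.
move=> QP; rewrite /least_nat; case: pselect => [exP|nP]; case: pselect => [exQ|nQ].
- rewrite lee_fin ler_nat; case: ex_minnP => m _; apply.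
  by case: ex_minnP => k /asboolP/QP/asboolP.
- exact: leey.
- by case: nP; case: exQ => k /asboolP/QP Pk; exists k; apply/asboolP.
- by [].
Qed.

Lemma continuous_pair (X Y Z : topologicalType) (f : X -> Y) (g : X -> Z) :
  continuous f -> continuous g -> continuous (fun x => (f x, g x)).
Proof. by move=> cf cg x; apply: cvg_pair; [exact: cf|exact: cg]. Qed.

Lemma continuous_comp_fun (X Y Z : topologicalType) (f : X -> Y) (g : Y -> Z) :
  continuous f -> continuous g -> continuous (fun x => g (f x)).
Proof. by move=> cf cg x; apply: continuous_comp; [exact: cf|exact: cg]. Qed.

(** * Operations on homotopies *)

Section homotopic.
Context (R : realType).
Implicit Types X Y Z : topologicalType.

Lemma homotopic_sym Y Z (f g : Y -> Z) : homotopic R f g -> homotopic R g f.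
Proof.
case=> H [cH H0 H1].
exists (fun p : Y * unit_interval R => H (p.1, clip (1 - val p.2))); split.
- apply: (continuous_comp_fun _ cH); apply: continuous_pair.
    by move=> p; exact: cvg_fst.
  apply: (continuous_comp_fun _ (@clip_continuous R)) => p.
  apply: cvgB; first exact: cvg_cst.
  by apply: continuous_comp; [exact: cvg_snd|exact: val_continuous].
- by move=> y /=; rewrite subr0 clip1.
- by move=> y /=; rewrite subrr clip0.
Qed.

Lemma homotopic_trans Y Z (f g h : Y -> Z) :
  homotopic R f g -> homotopic R g h -> homotopic R f h.
Proof.
case=> F [cF F0 F1] [G [cG G0 G1]].
pose first_half (p : Y * unit_interval R) := F (p.1, clip (2 * val p.2)).
pose second_half (p : Y * unit_interval R) := G (p.1, clip (2 * val p.2 - 1)).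
have cval : continuous (fun p : Y * unit_interval R => val p.2 : R).
  by move=> p; apply: continuous_comp; [exact: cvg_snd|exact: val_continuous].
have c2val : continuous (fun p : Y * unit_interval R => 2 * val p.2 : R).
  by move=> p; apply: cvgM; [exact: cvg_cst|exact: cval].
have cclip (K : Y * unit_interval R -> Z) (r : Y * unit_interval R -> R) :
    continuous K -> continuous r ->
    continuous (fun p : Y * unit_interval R => K (p.1, clip (r p))).
  move=> cK cr; apply: (continuous_comp_fun _ cK); apply: continuous_pair.
    by move=> p; exact: cvg_fst.
  exact: (continuous_comp_fun cr (@clip_continuous R)).
have cfirst : continuous first_half by exact: cclip.
have csecond : continuous second_half.
  by apply: cclip => // p; apply: cvgB; [exact: c2val|exact: cvg_cst].
pose A := [set p : Y * unit_interval R | val p.2 <= 2^-1 :> R].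
pose B := [set p : Y * unit_interval R | 2^-1 <= val p.2 :> R].
exists (fun p => if val p.2 <= 2^-1 then first_half p else second_half p); split.
(* The closed halves [A] and [B] of the cylinder meet at time 1/2, where both branches equal [g], so
   continuity can be checked on each half. *)
- apply/continuous_subspace_setT.
  have <- : A `|` B = setT.
    by apply/seteqP; split=> // p _; case: (leP (val p.2) (2^-1)) => [|/ltW];
      [left|right].
  apply: withinU_continuous.
  + by apply: (@preimage_closed _ _ _ [set r : R | r <= 2^-1]) => [p _|];
      [exact: cval|exact: closed_le].
  + by apply: (@preimage_closed _ _ _ [set r : R | 2^-1 <= r]) => [p _|];
      [exact: cval|exact: closed_ge].
  + apply: (@subspace_eq_continuous _ _ _ first_half);
      last exact: continuous_subspaceT.
    by move=> p; rewrite inE /A /= /from_subspace => ->.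
  + apply: (@subspace_eq_continuous _ _ _ second_half);
      last exact: continuous_subspaceT.
    move=> p; rewrite inE /B /= /from_subspace => ple; case: ifP => // pge.
    have p2 : val p.2 = 2^-1 by apply/eqP; rewrite eq_le pge.
    by rewrite /first_half /second_half p2 divff // subrr clip1 clip0 F1 G0.
- by move=> y /=; rewrite /first_half /= invr_ge0 ler0n mulr0 clip0 F0.
- move=> y /=; rewrite invf_ge1// lern1 /second_half /= mulr1 [2]mulr2n addrK.
  by rewrite clip1 G1.
Qed.

Lemma homotopic_compl X Y Z (f g : X -> Y) (h : Y -> Z) : continuous h ->
  homotopic R f g -> homotopic R (h \o f) (h \o g).
Proof.
move=> ch [H [cH H0 H1]]; exists (h \o H); split => [|y|y] /=.
- exact: continuous_comp_fun cH ch.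
- by rewrite H0.
- by rewrite H1.
Qed.

Lemma homotopic_compr X Y Z (f g : Y -> Z) (h : X -> Y) : continuous h ->
  homotopic R f g -> homotopic R (f \o h) (g \o h).
Proof.
move=> ch [H [cH H0 H1]]; exists (fun p => H (h p.1, p.2)); split => [|y|y] //=.
apply: (continuous_comp_fun _ cH); apply: continuous_pair.
  by apply: (continuous_comp_fun _ ch) => p; exact: cvg_fst.
by move=> p; exact: cvg_snd.
Qed.

Lemma prod_topology_continuous (I : Type) (Y : topologicalType)
    (T : I -> topologicalType) (f : Y -> prod_topology T) :
  (forall i, continuous (fun y => f y i)) -> continuous f.
Proof.
move=> cf y; apply/cvg_sup => i.
have : continuous (f : Y -> initial_topology (@proj I T i)).
  by apply: continuous_comp_initial; exact: cf.
exact.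
Qed.

(** One homotopy is chosen per coordinate; together they are continuous because continuity into a
    product is coordinatewise. *)
Lemma homotopic_prod (I : Type) (Y : topologicalType) (T : I -> topologicalType)
    (f g : Y -> prod_topology T) :
  (forall i, homotopic R (fun y => f y i) (fun y => g y i)) -> homotopic R f g.
Proof.
move=> hfg; exists (fun p i => sval (cid (hfg i)) p); split => [|y|y].
- by apply: prod_topology_continuous => i; case: cid => H [] /=.
- by apply: functional_extensionality_dep => i; case: cid => H [] /=.
- by apply: functional_extensionality_dep => i; case: cid => H [] /=.
Qed.

End homotopic.

(** * Arms of the star and evaluation along them *)

Section star.
Context (R : realType) (n : nat) (X : topologicalType).

Definition arm (i : 'I_n) : unit_interval R -> star R n :=
  @wedge_lift 'I_n (fun _ => unit_interval R) (fun _ => zero) i.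

Definition along_arm (i : 'I_n) (gamma : mapping_space (star R n) X) :
    unit_interval R -> X :=
  (gamma : continuousType (star R n) X) \o arm i.

Lemma arm_continuous i : continuous (arm i).
Proof.
exact: (@wedge_lift_continuous 'I_n (fun _ => unit_interval R) (fun _ => zero)).
Qed.

(** The exponential law: a continuous map into a space of maps with the compact-open topology
    uncurries to a jointly continuous one, as the interval is compact and regular. *)
Lemma along_arm_continuous (i : 'I_n) : continuous (uncurry (along_arm i)).
Proof.
apply: continuous_uncurry_regular.
- move=> t _; rewrite withinET; exists setT; first exact: filterT.
  by split; [exact: unit_interval_compact|exact: closedT].
- exact: unit_interval_regular.
- move=> gamma.
  have FF := fmap_filter (along_arm i) (nbhs_filter gamma).
  apply/compact_open_cvgP => K O cK oO gKO.
  have cg : continuous (fun g : mapping_space (star R n) X =>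
      (g : continuousType (star R n) X) : {compact-open, star R n -> X}).
    exact: initial_continuous.
  have /(cg gamma) : nbhs ((gamma : continuousType (star R n) X)
      : {compact-open, star R n -> X}) [set g | g @` (arm i @` K) `<=` O].
    apply: open_nbhs_nbhs; split.
      apply: compact_open_open => //; apply: continuous_compact => //.
      exact/continuous_subspaceT/arm_continuous.
    by move=> _ [_ [t Kt <-] <-]; apply: gKO; exists t.
  move=> nU; apply: (@filterS _ _ (nbhs_filter gamma) _ _ _ nU) => g gO _ [t Kt <-].
  by apply: gO; exists (arm i t) => //; exists t.
- move=> gamma.
  exact: (continuous_comp_fun (@arm_continuous i)
    (@cts_fun _ _ (gamma : continuousType (star R n) X))).
Qed.

(** The homotopy parameter is the position on the arm, running from the centre to the end where
    [star_eval] evaluates. *)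
Lemma homotopic_arm (Y : topologicalType)
    (s : Y -> mapping_space (star R n) X) (i : 'I_n) :
  continuous s ->
  homotopic R (fun y => along_arm i (s y) zero) (fun y => star_eval (s y) i).
Proof.
move=> cs; exists (fun p => uncurry (along_arm i) (s p.1, p.2)); split => //.
apply: (continuous_comp_fun _ (@along_arm_continuous i)); apply: continuous_pair.
  by apply: (continuous_comp_fun _ cs) => p; exact: cvg_fst.
by move=> p; exact: cvg_snd.
Qed.

Lemma along_arm_zero (i j : 'I_n) (gamma : mapping_space (star R n) X) :
  along_arm i gamma zero = along_arm j gamma zero.
Proof.
have e : arm i zero = arm j zero.
  exact: (@wedge_liftE 'I_n (fun _ => unit_interval R) (fun _ => zero)
    j zero i zero).
by rewrite /along_arm /= e.
Qed.

(** Paths from [x] to the coordinates of [z] share their starting point, so they glue at the centre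
    of the star. *)
Lemma star_eval_surjective (x : X) (z : cart_power X n) :
  path_connected R X ->
  exists gamma : mapping_space (star R n) X, star_eval gamma = z.
Proof.
move=> pcX; pose p i := inhabited_witness (pcX x (z i)).
pose f :=
  @wedge_fun 'I_n (fun _ => unit_interval R) (fun _ => zero) X (fun i => p i).
have pz i j : p i zero = p j zero by rewrite !path_zero.
have cf : continuous f.
  by apply: wedge_fun_continuous => [i|//]; exact: cts_fun.
pose gamma : continuousType (star R n) X :=
  HB.pack f (isContinuous.Build _ _ f cf).
exists gamma; apply: functional_extensionality_dep => i.
by rewrite /star_eval /= /f wedge_lift_funE // path_one.
Qed.

End star.

(** * The two inequalities *)

Lemma coordinate_continuous (X : topologicalType) (m : nat) (i : 'I_m) :
  continuous (fun z : cart_power X m => z i).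
Proof. exact: (@proj_continuous 'I_m (fun=> X) i). Qed.

Lemma LS_category_le_topological_complexity (R : realType) (X : topologicalType)
    (m : nat) :
  (LS_category R (cart_power X m) <= topological_complexity R m.+1 X)%E.
Proof.
apply: least_nat_le => k [U [[oU cU] sU]].
have [[x0]|X0] := pselect (inhabited X); last first.
  (* If [X] is empty, its power has at most one point (exactly one for [m = 0]), so inclusions are
     already constant. *)
  have eqX (y y' : cart_power X m) : y = y'.
    by apply/funext => i; case: X0; constructor; exact: y i.
  exists (fun=> setT); split.
    by split=> [?|]; [exact: openT|apply/seteqP; split=> // y _; exists ord0].
  move=> _; exists set_val => [y y'|]; first exact: eqX.
  exists (set_val \o fst); split=> // p.
  by apply: continuous_comp; [exact: cvg_fst|exact: initial_continuous].
(* [unlift ord0 i] is [None] only at index 0, so [j] puts [x0] there and shifts the coordinates of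
   [y] up by one. *)
pose j (y : cart_power X m) : cart_power X m.+1 :=
  fun i => oapp y x0 (unlift ord0 i).
have cj : continuous j.
  apply: prod_topology_continuous => i; rewrite /j.
  case: (unlift ord0 i) => [l|] /=; last exact: cst_continuous.
  exact: coordinate_continuous.
exists (fun i => j @^-1` U i); split.
  split=> [i|]; first by apply: open_comp => // y _; exact: cj.
  apply/seteqP; split=> // y _.
  by have [i _ Ui] : (\bigcup_i U i) (j y) by [rewrite cU]; exists i.
move=> i; have [s cs Hs] := sU i.
(* [j] restricted to the pulled-back set, with values in [U i], so that [s] can be applied after
   it. *)
pose jA (a : set_type (j @^-1` U i)) : set_type (U i) :=
  exist _ (j (set_val a)) (mem_set (set_mem (valP a))).
have cjA : continuous jA.
  apply: continuous_comp_initial.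
  exact: (continuous_comp_fun (@initial_continuous _ _ set_val) cj).
have csj : continuous (s \o jA) by exact: (continuous_comp_fun cjA cs).
have {}Hs l : homotopic R (fun a => star_eval (s (jA a)) l)
    (fun a => j (set_val a) l).
  exact: (homotopic_compl (@coordinate_continuous X m.+1 l)
    (homotopic_compr cjA Hs)).
exists (fun=> fun=> x0) => //; apply: homotopic_prod => l.
have jl y : j y (lift ord0 l) = y l by rewrite /j liftK.
have j0 y : j y ord0 = x0 by rewrite /j unlift_none.
have := homotopic_trans (homotopic_arm (lift ord0 l) csj) (Hs (lift ord0 l)).
have := homotopic_trans (homotopic_arm ord0 csj) (Hs ord0).
under [X in homotopic _ _ X -> _]eq_fun do rewrite j0.
under [X in _ -> homotopic _ _ X -> _]eq_fun do rewrite jl.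
under eq_fun do rewrite (along_arm_zero ord0 (lift ord0 l)).
(* Both homotopies now start at the common centre: [H0] ends at [x0] and [Hl] at coordinate [l], so
   [Hl] is reversed before concatenation. *)
move=> H0 Hl; exact: homotopic_trans (homotopic_sym Hl) H0.
Qed.

Lemma topological_complexity_le_LS_category (R : realType) (X : topologicalType)
    (n : nat) : path_connected R X -> (0 < n)%N ->
  (topological_complexity R n X <= LS_category R (cart_power X n))%E.
Proof.
move=> pcX n0; apply: least_nat_le => k [A [cA nA]]; exists A; split=> // i.
(* A point of [A i] is needed to read off the constant value of [c]; over an empty set the section
   and the homotopy are vacuous. *)
have [[a]|A0] := pselect (inhabited (set_type (A i))).
  have [c cc Hc] := nA i.
  (* The centre of the star may be any point of [X]; positivity of [n] supplies coordinate 0 of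
     [c a]. *)
  have [gamma gammaE] := star_eval_surjective (c a (Ordinal n0)) (c a) pcX.
  exists (cst gamma); first exact: cst_continuous.
  have -> : star_eval (X:=X) \o cst gamma = c.
    by apply/funext => y /=; rewrite gammaE; exact: cc.
  exact: homotopic_sym.
exists (fun a => False_rect _ (A0 (inhabits a))).
  by move=> a; case: (A0 (inhabits a)).
exists (fun p => False_rect _ (A0 (inhabits p.1))).
split => [p|a|a]; first by case: (A0 (inhabits p.1)).
all: by case: (A0 (inhabits a)).
Qed.

Theorem corollary3p3 (R : realType) (X : topologicalType) (n : nat) :
  path_connected R X -> (2 <= n)%N ->
  (LS_category R (cart_power X n.-1) <= topological_complexity R n X)%E /\
  (topological_complexity R n X <= LS_category R (cart_power X n))%E.
Proof.
move=> pcX n2; split; last first.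
  by apply: topological_complexity_le_LS_category => //; exact: ltnW.
by case: n n2 => // m _; exact: LS_category_le_topological_complexity.
Qed.
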